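(* (1) Let $M_2=\{0,a,b,1\}$ be the $4$-element quasi-antichain (with atoms $a,b$). There are exactly $36$ difference operators on $M_2$, namely: (a) $9$ derivations; (b) $9$ difference operators $d$ with $d(0)=a$: $\mathbf{C}_{(a)}$, $(\mathbf{C}_{(a)})^{0}$, $\lambda_a$, $\psi_{(a)}$, $(\psi_{(a)})^{u}$ for all $u\in M_2\setminus\{1\}$, $\Phi_a$, and $(\Phi_a)^{0}$; (c) $9$ difference operators $d$ with $d(0)=b$, given in the same way as in (b) with the roles of $a$ and $b$ interchanged; (d) $9$ difference operators $d$ with $d(0)=1$: $\mathbf{C}_{(1)}$, $(\mathbf{C}_{(1)})^{u}$ for all $u\in M_2\setminus\{1\}$, $\phi_1$, $\phi_2$, $(\phi_1)^{0}$, $(\phi_2)^{0}$, and $\phi_3$. (2) For $n\ge 5$, let $M_{n-2}$ be the $n$-element quasi-antichain (with $n-2$ atoms). Then $$|\mathrm{DW}_1(M_{n-2})|=\frac{3n^3-22n^2+61n-50}{2}+\sum_{k=1}^{n-2}(k+1)\binom{n-2}{k}.$$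
   Context: A quasi-antichain is a lattice consisting of a top element $1$, a bottom element $0$, and atoms (so any two distinct elements other than $0,1$ have meet $0$ and join $1$). A derivation on a lattice $L$ is a map $d:L\to L$ with $d(x\wedge y)=(d(x)\wedge y)\vee(x\wedge d(y))$ for all $x,y\in L$. A difference operator on $L$ is a map $d:L\to L$ with $d(x\wedge y)=(d(x)\wedge y)\vee(x\wedge d(y))\vee(d(x)\wedge d(y))$ for all $x,y\in L$; the set of these is $\mathrm{DW}_1(L)$. Notation: for $c\in L$, $\mathbf{C}_{(c)}$ is the constant operator $x\mapsto c$, and $\psi_{(c)}(x)=x\vee c$. For an operator $d$ on a lattice with top $1$ and an element $u$, $d^{u}$ is the operator with $d^{u}(1)=u$ and $d^{u}(x)=d(x)$ for $x\ne 1$. For an atom $c$, $\lambda_c(x)=0$ if $x\in\{c,1\}$ and $\lambda_c(x)=c$ otherwise. On $M_2$, writing an operator as the list of its values at $(0,a,b,1)$: $\Phi_a=(a,0,1,b)$, $\Phi_b=(b,1,0,a)$, $\phi_1=(1,b,1,b)$, $\phi_2=(1,1,a,a)$, $\phi_3=(1,b,a,0)$. *)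

(* Defs.v *)
From mathcomp Require Import all_boot all_order all_algebra.

Set Implicit Arguments.
Unset Strict Implicit.
Unset Printing Implicit Defensive.

Import Order.LTheory.
Local Open Scope order_scope.

Definition atom disp (L : finTBLatticeType disp) (x : L) : Prop :=
  \bot < x /\ forall y : L, y < x -> y = \bot.

Definition quasi_antichain disp (L : finTBLatticeType disp) : Prop :=
  forall x : L, [\/ x = \bot, x = \top | atom x].

(* Operators on L are finite functions, so that sets of operators can be
   counted. *)
Definition Der disp (L : finTBLatticeType disp) : {set {ffun L -> L}} :=
  [set d : {ffun L -> L} | [forall x, forall y,
     d (x `&` y) == (d x `&` y) `|` (x `&` d y)]].

Definition DW1 disp (L : finTBLatticeType disp) : {set {ffun L -> L}} :=
  [set d : {ffun L -> L} | [forall x, forall y,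
     d (x `&` y) == (d x `&` y) `|` (x `&` d y) `|` (d x `&` d y)]].

Section Operators.

Variables (disp : Order.disp_t) (L : finTBLatticeType disp).
Implicit Types (a b c u : L) (d : {ffun L -> L}).

Definition Cop c : {ffun L -> L} := [ffun=> c].

Definition psi c : {ffun L -> L} := [ffun x => x `|` c].

(* The operator $d^u$. *)
Definition at_top d u : {ffun L -> L} :=
  [ffun x => if x == \top then u else d x].

Definition lambda c : {ffun L -> L} :=
  [ffun x => if (x == c) || (x == \top) then \bot else c].

(* When L = {0, a, b, 1} has four elements, the operator whose list of values
   at (0, a, b, 1) is (v0, va, vb, v1). *)
Definition op4 a b (v0 va vb v1 : L) : {ffun L -> L} :=
  [ffun x => if x == \bot then v0 else
             if x == a then va else
             if x == b then vb else v1].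

(* In terms of the two atoms a, b of M_2, Phi a b is $\Phi_a$ and Phi b a is
   $\Phi_b$: exchanging a and b turns (a,0,1,b) into (b,1,0,a) as lists of
   values at (0,a,b,1). *)
Definition Phi a b := op4 a b a \bot \top b.
Definition phi1 a b := op4 a b \top b \top b.
Definition phi2 a b := op4 a b \top \top a a.
Definition phi3 a b := op4 a b \top b a \bot.

Definition M2_ops_atom a b : {set {ffun L -> L}} :=
  [set Cop a; at_top (Cop a) \bot; lambda a; psi a;
       Phi a b; at_top (Phi a b) \bot]
  :|: [set at_top (psi a) u | u in [set~ \top]].

Definition M2_ops_top a b : {set {ffun L -> L}} :=
  [set Cop \top; phi1 a b; phi2 a b;
       at_top (phi1 a b) \bot; at_top (phi2 a b) \bot; phi3 a b]
  :|: [set at_top (Cop \top) u | u in [set~ \top]].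

End Operators.

(* Main.v *)
Require Import Defs.
From mathcomp Require Import all_boot all_order all_algebra.
From mathcomp Require Import ring zify.

(** Why the theorem holds.

    A meet is the top only if both of its factors are, so the value d(1) of a
    difference operator d meets the other values of d only in the rule for the
    pairs (x, 1), and there the rule reads: x /\ d(1) <= d(x).  Hence the
    difference operators fibre over those that send 1 to 0, and the fibre of
    such a g is the set [top_values g] of the u with x /\ u <= g(x) for all
    x <> 1 ([at_top_DW1], [card_DW1_from]).  In a quasi-antichain 0 is always
    admissible, an atom x is exactly when x <= g(x), and 1 is exactly when all
    atoms are, so the size of a fibre only depends on the number of atoms with
    x <= g(x) ([card_top_values]).

    It remains to list, for each value of g(0), the g with g(1) = 0.  Let m be
    the number of atoms.
    - If g(0) = 0, the rule for pairs of distinct atoms amounts to g(x) <= x, so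
      g is the identity on a set S of atoms and 0 elsewhere.  The fibre has
      1 + |S| elements, plus one if S contains all atoms; summing over S gives
      the binomial sum (with its term k = 0) plus 1.  These difference
      operators are exactly the derivations ([Der_qa]).
    - If g(0) is an atom c and m >= 3, a third atom forces g(x) = c at each atom
      x <> c, and then g(c) is c or 0.  The fibres have 2 and 1 elements, so
      each c contributes 3.
    - If g(0) = 1, each atom goes to 1 or to another atom, and two atoms that do
      not go to 1 are exchanged by g; so at most two atoms deviate from the
      value 1.  There are 1, m (m - 1) and 'C(m, 2) such g with 0, 1 and 2
      deviating atoms, and their fibres have m + 2, m and m - 1 elements.
    With n = m + 2 the sum of the three contributions is the claimed formula.

    For m = 2 there is no third atom and the second class is larger.  But M_2 is
    the Boolean algebra of pairs of bits, an operator on it is a table of four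
    such pairs, and inspecting the 256 tables determines the classes with
    d(0) = a and d(0) = 1; exchanging the atoms gives the class with d(0) = b,
    and the class with d(0) = 0 is the one counted above for general m. *)

Set Implicit Arguments.
Unset Strict Implicit.
Unset Printing Implicit Defensive.

Import Order.LTheory.
Local Open Scope order_scope.

(** * Difference operators and their value at the top *)

Section Lattice.

Context {disp : Order.disp_t} {L : finTBLatticeType disp}.
Implicit Types (a b c u v x y : L) (d g : {ffun L -> L}).

Definition product_rule d x y : L :=
  (d x `&` y) `|` (x `&` d y) `|` (d x `&` d y).

Lemma DW1P d :
  reflect (forall x y, d (x `&` y) = product_rule d x y) (d \in DW1 L).
Proof.
rewrite inE; apply: (iffP forallP) => [dP x y | dP x].
  by apply/eqP; have /forallP := dP x.
by apply/forallP => y; apply/eqP/dP.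
Qed.

Lemma product_ruleC d x y : product_rule d x y = product_rule d y x.
Proof.
by rewrite /product_rule [d x `&` y]meetC [x `&` d y]meetC [d x `&` d y]meetC
           [(y `&` _) `|` _]joinC.
Qed.

Lemma product_rulexx d x : product_rule d x x = d x.
Proof. by rewrite /product_rule [x `&` _]meetC joinxx meetxx meetUKC. Qed.

Lemma product_rulex0 d x :
  product_rule d x \bot = (x `&` d \bot) `|` (d x `&` d \bot).
Proof. by rewrite /product_rule meetx0 join0x. Qed.

Lemma product_rulex1 d x : product_rule d x \top = d x `|` (x `&` d \top).
Proof. by rewrite /product_rule meetx1 joinAC meetKU. Qed.

Lemma at_top_top d u : at_top d u \top = u.
Proof. by rewrite ffunE eqxx. Qed.

Lemma at_topF d u x : x != \top -> at_top d u x = d x.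
Proof. by rewrite ffunE => /negPf->. Qed.

Lemma at_top_id d : at_top d (d \top) = d.
Proof. by apply/ffunP => x; rewrite ffunE; case: eqP => // ->. Qed.

Lemma at_top_at_top d u v : at_top (at_top d u) v = at_top d v.
Proof. by apply/ffunP => x; rewrite !ffunE; case: eqP. Qed.

(** The values that may be put at the top of a difference operator that agrees
    with [d] elsewhere. *)
Definition top_values d : {set L} :=
  [set u | [forall x, (x != \top) ==> (x `&` u <= d x)]].

Lemma top_valuesP d u :
  reflect (forall x, x != \top -> x `&` u <= d x) (u \in top_values d).
Proof.
rewrite inE; apply: (iffP forallP) => dP x; first exact/implyP.
by apply/implyP/dP.
Qed.

Lemma bot_in_top_values d : \bot \in top_values d.
Proof. by apply/top_valuesP => x _; rewrite meetx0 le0x. Qed.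

Lemma top_values_at_top d u : top_values (at_top d u) = top_values d.
Proof.
apply/setP => v; apply/top_valuesP/top_valuesP => dP x xN1;
  by have := dP x xN1; rewrite at_topF.
Qed.

(** Replacing the value at the top leaves the rule unchanged for pairs of elements
    below the top, whose meet is also below the top; for a pair (x, 1) the rule
    says that x /\ u is absorbed by d(x), and for (1, 1) it is void. *)
Lemma at_top_DW1 d u :
  (at_top d u \in DW1 L) = (at_top d \bot \in DW1 L) && (u \in top_values d).
Proof.
have ruleF v x y : x != \top -> y != \top ->
    (at_top d v (x `&` y) == product_rule (at_top d v) x y)
    = (d (x `&` y) == product_rule d x y).
  move=> xN1 yN1; rewrite /product_rule !at_topF //.
  by apply: contraNneq xN1 => xy1; rewrite -le1x -xy1 leIl.
have rule1 v x : x != \top ->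
    (at_top d v (x `&` \top) == product_rule (at_top d v) x \top)
    = (x `&` v <= d x).
  move=> xN1; rewrite meetx1 product_rulex1 at_top_top at_topF // eq_sym.
  by rewrite eq_joinl.
apply/DW1P/andP => [dP | [/DW1P dP /top_valuesP uP]].
  split; last first.
    by apply/top_valuesP => x xN1; rewrite -rule1 // dP.
  (* By symmetry of the rule, y = 1 is only met together with x = 1. *)
  apply/DW1P => x y; apply/eqP; wlog yx : x y / (y == \top) ==> (x == \top).
    move=> wl; case: (boolP ((y == \top) ==> (x == \top))); first exact: wl.
    rewrite negb_imply => /andP[y1 /negPf xN1].
    by rewrite meetC product_ruleC wl // xN1.
  case: (eqVneq x \top) yx => [-> _|xN1]; last first.
    by rewrite implybF => yN1; rewrite ruleF // -(ruleF u) // dP.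
  case: (eqVneq y \top) => [->|yN1]; first by rewrite meetxx product_rulexx.
  by rewrite meetC product_ruleC rule1 // meetx0 le0x.
move=> x y; apply/eqP.
case: (eqVneq x \top) => [->|xN1]; case: (eqVneq y \top) => [->|yN1].
- by rewrite meetxx product_rulexx.
- by rewrite meetC product_ruleC rule1 ?uP.
- by rewrite rule1 ?uP.
by rewrite ruleF // -(ruleF \bot) // dP.
Qed.

Lemma at_top_bot_DW1 d : d \in DW1 L -> at_top d \bot \in DW1 L.
Proof. by rewrite -{1}(at_top_id d) at_top_DW1 => /andP[]. Qed.

Lemma DW1_top_values d : d \in DW1 L -> d \top \in top_values d.
Proof. by rewrite -{1}(at_top_id d) at_top_DW1 => /andP[]. Qed.

(** The base points, over the value [v] at the bottom, of the fibration by
    restriction to the elements below the top; 0 is always admissible at the top,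
    so it is used to single out one point in each fibre. *)
Definition bases v : {set {ffun L -> L}} :=
  [set g in DW1 L | (g \bot == v) && (g \top == \bot)].

(** Each fibre of [d |-> at_top d 0] is in bijection with the admissible values at
    the top; the bottom must differ from the top for the value at the bottom to
    be constant along fibres. *)
Lemma card_DW1_from v : \bot != \top :> L ->
  #|[set d in DW1 L | d \bot == v]| = (\sum_(g in bases v) #|top_values g|)%N.
Proof.
move=> N01; rewrite -sum1_card.
rewrite (partition_big (fun d => at_top d \bot) (mem (bases v))) /=; last first.
  move=> d; rewrite inE => /andP[dD d0]; rewrite inE at_topF //.
  rewrite d0 at_top_top eqxx.
  by rewrite at_top_bot_DW1.
apply: eq_bigr => g; rewrite inE => /and3P[gD /eqP g0 /eqP g1].
have gE u : at_top (at_top g u) \bot = g.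
  by rewrite at_top_at_top -{1}g1 at_top_id.
have inj : {in top_values g &, injective (at_top g)}.
  by move=> u w _ _ /ffunP/(_ \top); rewrite !at_top_top.
rewrite sum1_card -(card_in_imset inj); apply: eq_card => d.
rewrite -topredE /= inE; apply/idP/imsetP.
  move=> /andP[/andP[dD _] /eqP dg]; exists (d \top).
    by rewrite -dg top_values_at_top DW1_top_values.
  by rewrite -dg at_top_at_top at_top_id.
case=> u uW ->; rewrite at_top_DW1 uW at_topF // g0 !eqxx gE eqxx.
by rewrite -{1}g1 at_top_id gD.
Qed.

Lemma card_DW1_sum :
  #|DW1 L| = (\sum_(v : L) #|[set d in DW1 L | d \bot == v]|)%N.
Proof.
rewrite -sum1_card (partition_big (fun d => d \bot) xpredT) //=.
by apply: eq_bigr => v _; rewrite -sum1_card; apply: eq_bigl => d; rewrite inE.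
Qed.

(** A derivation is contracting (take x = y in the rule), and for a contracting
    operator the extra term d(x) /\ d(y) of the difference rule is absorbed by
    d(x) /\ y. *)
Lemma Der_DW1 : Der L = [set d in DW1 L | [forall x, d x <= x]].
Proof.
apply/setP => d.
have ruleE x y : (forall z, d z <= z) ->
    product_rule d x y = (d x `&` y) `|` (x `&` d y).
  move=> dle; apply: join_l; apply: le_trans (leUl _ _).
  by apply: leI2.
apply/idP/idP => [|/setIdP[/DW1P dD /forallP dle]]; rewrite inE.
  move=> /forallP dD.
  have dR x y : d (x `&` y) = (d x `&` y) `|` (x `&` d y).
    by apply/eqP; have /forallP := dD x.
  have dle x : d x <= x.
    by have := dR x x; rewrite meetxx [x `&` _]meetC joinxx => ->; apply: leIr.
  rewrite inE; apply/andP; split; last exact/forallP.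
  by apply/DW1P => x y; rewrite ruleE.
by apply/forallP => x; apply/forallP => y; rewrite dD ruleE.
Qed.

Lemma Cop_DW1 c : Cop c \in DW1 L.
Proof.
apply/DW1P => x y; rewrite /product_rule !ffunE meetxx.
by apply/esym/join_r; rewrite leUx leIl leIr.
Qed.

End Lattice.

(** * Quasi-antichains *)

(** In a quasi-antichain these are the atoms. *)
Definition atom_set {disp} (L : finTBLatticeType disp) : {set L} :=
  [set x | (x != \bot) && (x != \top)].

Section QuasiAntichain.

Context {disp : Order.disp_t} {L : finTBLatticeType disp}.
Hypothesis qaL : quasi_antichain L.
Implicit Types (a b c u v x y z : L) (d g : {ffun L -> L}).

Local Notation atoms := (atom_set L).

Lemma atomN0 x : x \in atoms -> x != \bot.
Proof. by rewrite inE => /andP[]. Qed.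

Lemma atomN1 x : x \in atoms -> x != \top.
Proof. by rewrite inE => /andP[]. Qed.

Lemma atom_nontrivial x : x \in atoms -> \bot != \top :> L.
Proof.
by move=> /atomN0; apply: contraNneq => bot_top; rewrite -lex0 bot_top lex1.
Qed.

Variant bot_top_atom_spec : L -> Type :=
  | BotSpec : bot_top_atom_spec \bot
  | TopSpec : bot_top_atom_spec \top
  | AtomSpec x of x \in atoms : bot_top_atom_spec x.

Lemma bot_top_atomP x : bot_top_atom_spec x.
Proof.
case: (eqVneq x \bot) => [->|x0]; first exact: BotSpec.
case: (eqVneq x \top) => [->|x1]; first exact: TopSpec.
by apply: AtomSpec; rewrite inE x0 x1.
Qed.

Lemma lt_atom x y : x \in atoms -> (y < x) = (y == \bot).
Proof.
move=> xA; apply/idP/eqP => [yx|->]; last by rewrite lt0x atomN0.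
case: (qaL x) => [x0|x1|[_ x_min]]; last exact: x_min.
  by move: (atomN0 xA); rewrite x0 eqxx.
by move: (atomN1 xA); rewrite x1 eqxx.
Qed.

Lemma le_atom x y : x \in atoms -> (y <= x) = (y == \bot) || (y == x).
Proof. by move=> xA; rewrite le_eqVlt lt_atom // orbC. Qed.

Lemma atom_le x y : x \in atoms -> (x <= y) = (y == \top) || (y == x).
Proof.
move=> xA; case: (bot_top_atomP y) => [||z zA].
- by rewrite lex0 (negPf (atom_nontrivial xA)) eq_sym.
- by rewrite lex1 eqxx.
by rewrite le_atom // (negPf (atomN0 xA)) (negPf (atomN1 zA)) eq_sym.
Qed.

Lemma meet_atom x y : x \in atoms ->
  x `&` y = if (y == \top) || (y == x) then x else \bot.
Proof.
move=> xA; rewrite -atom_le //; case: ifPn => [/meet_l //|xy].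
have := leIl x y; rewrite le_atom // => /orP[/eqP //|].
by rewrite eq_meetl (negPf xy).
Qed.

Lemma join_atom x y : x \in atoms ->
  x `|` y = if (y == \bot) || (y == x) then x else \top.
Proof.
move=> xA; rewrite -le_atom //; case: ifPn => [/join_l //|xy].
have := leUl x y; rewrite atom_le // => /orP[/eqP //|].
by rewrite eq_joinl (negPf xy).
Qed.

(** The rule needs to be checked only for pairs with meet the bottom that contain
    an atom, and for the pairs (x, 1); the latter condition is the admissibility
    of d(1). *)
Lemma DW1_qaP d :
  reflect [/\ d \top \in top_values d,
              forall x, x \in atoms -> d \bot = product_rule d x \bot &
              forall x y, x \in atoms -> y \in atoms -> x != y ->
                d \bot = product_rule d x y]
          (d \in DW1 L).
Proof.
have meetA0 x y : x \in atoms -> y \in atoms -> x != y -> x `&` y = \bot.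
  move=> xA yA xy.
  by rewrite meet_atom // (negPf (atomN1 yA)) eq_sym (negPf xy).
apply: (iffP idP) => [dD|[d1 d0 dA]].
  have dR x y : d (x `&` y) = product_rule d x y by apply/DW1P.
  split=> [|x xA|x y xA yA xy]; last by rewrite -dR meetA0.
    exact: DW1_top_values.
  by rewrite -dR meetx0.
have rule1 x : d x = product_rule d x \top.
  rewrite product_rulex1; apply/esym/join_l.
  case: (eqVneq x \top) => [->|xN1]; first by rewrite meet1x.
  exact: (top_valuesP _ _ d1).
have rule0 x : d \bot = product_rule d x \bot.
  case: (bot_top_atomP x) => [||y yA]; last exact: d0.
    by rewrite product_rulexx.
  by rewrite product_ruleC -rule1.
apply/DW1P => x y; case: (bot_top_atomP x) => [||{}x xA].
- by rewrite meet0x product_ruleC.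
- by rewrite meet1x product_ruleC.
case: (bot_top_atomP y) => [||{}y yA].
- by rewrite meetx0.
- by rewrite meetx1.
case: (eqVneq x y) => [->|xy]; first by rewrite meetxx product_rulexx.
by rewrite meetA0 //; apply: dA.
Qed.

Lemma sum_bot_top_atoms (F : L -> nat) : \bot != \top :> L ->
  (\sum_(v : L) F v = F \bot + F \top + \sum_(v in atoms) F v)%N.
Proof.
move=> N01; rewrite (bigD1 \bot) //= (bigD1 \top) /=; last by rewrite eq_sym.
by rewrite addnA; congr addn; apply: eq_bigl => v; rewrite inE.
Qed.

Lemma card_atom_set : \bot != \top :> L -> #|L| = #|atoms|.+2.
Proof.
move=> N01; rewrite -[LHS]sum1_card (eq_bigl xpredT) // sum_bot_top_atoms //.
by rewrite sum1_card.
Qed.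

(** The atoms that are admissible at the top, see [card_top_values]. *)
Definition up_atoms d : {set L} := [set x in atoms | x <= d x].

Lemma top_values_qaP d u :
  reflect (forall x, x \in atoms -> x <= u -> x <= d x) (u \in top_values d).
Proof.
apply: (iffP (top_valuesP _ _)) => [uP x xA xu | uP x xN1].
  by have := uP x (atomN1 xA); rewrite (meet_l xu).
case: (bot_top_atomP x) xN1 => [||y yA _]; [|by rewrite eqxx|].
  by rewrite meet0x le0x.
case: (boolP (y <= u)) => [yu|]; first by apply: leIxl; apply: uP.
by rewrite meet_atom // atom_le // => /negPf->; rewrite le0x.
Qed.

(** The bottom is always admissible and the top is so exactly when all atoms are,
    which explains the two corrections to the number of admissible atoms. *)
Lemma card_top_values d : \bot != \top :> L ->
  #|top_values d| = (#|up_atoms d|.+1 + (up_atoms d == atoms))%N.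
Proof.
move=> N01.
rewrite -[in LHS]sum1_card big_mkcond sum_bot_top_atoms //=.
have -> := bot_in_top_values d.
have -> : (\top \in top_values d) = (up_atoms d == atoms).
  apply/top_values_qaP/eqP => [dA | FA x]; last first.
    by rewrite -{1}FA inE => /andP[].
  apply/setP => x; rewrite inE; case: (boolP (x \in atoms)) => //= xA.
  by rewrite dA ?lex1.
rewrite add1n addSn addnC -[#|up_atoms d|]sum1_card [in RHS]big_mkcond addSn.
congr (_ + _).+1.
rewrite [LHS]big_mkcond; apply: eq_bigr => x _.
rewrite [x \in up_atoms d]inE; case: ifP => //= xA.
have -> // : (x \in top_values d) = (x <= d x).
apply/top_values_qaP/idP => [-> // | xd y yA].
by rewrite le_atom // (negPf (atomN0 yA)) => /eqP->.
Qed.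

(** * The operators that fix the bottom *)

Section TwoAtoms.

Hypothesis atoms_gt1 : (1 < #|atoms|)%N.

Lemma other_atom x : exists2 y, y \in atoms & y != x.
Proof.
have /card_gt0P[y] : (0 < #|atoms :\ x|)%N.
  by move: atoms_gt1; rewrite (cardsD1 x atoms); case: (x \in atoms) => // /ltnW.
by rewrite in_setD1 => /andP[yx yA]; exists y.
Qed.

Lemma bot_neq_top : \bot != \top :> L.
Proof. by have [y yA _] := other_atom \bot; apply: atom_nontrivial yA. Qed.

(** When d(0) = 0 the rule for atoms x <> y makes d(x) disjoint from y for all such
    y, and every element not below x lies above some such y. *)
Lemma DW1_botP d : d \bot = \bot ->
  reflect (d \top \in top_values d /\ forall x, x \in atoms -> d x <= x)
          (d \in DW1 L).
Proof.
move=> d0; apply: (iffP (DW1_qaP d)) => [[d1 _ dA]|[d1 dA]]; split=> //.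
- move=> x xA.
  have dxy y : y \in atoms -> y != x -> d x `&` y = \bot.
    move=> yA; rewrite eq_sym => xy; apply/eqP; have /esym/eqP := dA x y xA yA xy.
    by rewrite d0 /product_rule !join_eq0 => /andP[/andP[]].
  (* The value 1 is excluded by any second atom, an atom z <> x by z itself. *)
  case: (bot_top_atomP (d x)) dxy => [||z zA] dxy; first exact: le0x.
    have [y yA yx] := other_atom x; have := dxy y yA yx.
    by rewrite meet1x => y0; have := atomN0 yA; rewrite y0 eqxx.
  rewrite le_atom // (negPf (atomN0 zA)); apply: contraT => zx.
  by have /eqP := dxy z zA zx; rewrite meetxx (negPf (atomN0 zA)).
- by move=> x _; rewrite product_rulex0 d0 !meetx0 joinxx.
move=> x y xA yA xy; apply/esym/eqP; rewrite d0 -lex0.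
have <- : x `&` y = \bot.
  by rewrite meet_atom // (negPf (atomN1 yA)) eq_sym (negPf xy).
by rewrite /product_rule !leUx !leI2 // ?dA.
Qed.

Lemma Der_qa : Der L = [set d in DW1 L | d \bot == \bot].
Proof.
rewrite Der_DW1; apply/setP => d; apply/setIdP/setIdP => -[dD dle]; split=> //.
  by rewrite -lex0; apply: (forallP dle).
have [_ dA] := DW1_botP (eqP dle) dD.
apply/forallP => x; case: (bot_top_atomP x) => [||y yA].
- by rewrite (eqP dle).
- by rewrite lex1.
exact: dA.
Qed.

Definition id_on (S : {set L}) : {ffun L -> L} :=
  [ffun x => if x \in S then x else \bot].

Lemma id_on_eq0 (S : {set L}) x : S \subset atoms ->
  (id_on S x == \bot) = (x \notin S).
Proof.
move=> /subsetP SA; rewrite ffunE; case: ifPn => [/SA/atomN0/negPf //|_].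
by rewrite eqxx.
Qed.

Lemma id_on_inj : {in powerset atoms &, injective id_on}.
Proof.
move=> S T; rewrite !inE => SA TA ST; apply/setP => x.
by apply: negb_inj; rewrite -!id_on_eq0 // ST.
Qed.

Lemma bases_bot : bases \bot = id_on @: powerset atoms.
Proof.
apply/setP => g; apply/idP/imsetP => [/setIdP[gD /andP[/eqP g0 /eqP g1]] | [S]].
  exists [set x in atoms | g x == x].
    by rewrite inE; apply/subsetP => x /setIdP[].
  have [_ gA] := DW1_botP g0 gD.
  apply/ffunP => x; rewrite ffunE inE; case: (bot_top_atomP x) => [||y yA].
  - by rewrite g0 if_same.
  - by rewrite g1 inE eqxx andbF.
  rewrite yA; case: eqP => //= /eqP; have := gA y yA.
  by rewrite le_atom // => /orP[/eqP|->].
rewrite inE => SA ->.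
have Sx x : x \notin atoms -> id_on S x = \bot.
  move=> xA; apply/eqP; rewrite id_on_eq0 //; apply: contra xA.
  exact: (subsetP SA).
have S0 : id_on S \bot = \bot by apply: Sx; rewrite inE eqxx.
have S1 : id_on S \top = \bot by apply: Sx; rewrite inE eqxx andbF.
rewrite inE S0 S1 eqxx !andbT; apply/DW1_botP => //.
rewrite S1; split=> [|x _]; first exact: bot_in_top_values.
by rewrite ffunE; case: ifP => _; rewrite ?le0x.
Qed.

(** The identity on a set S of atoms has 1 + |S| admissible values at the top, and
    one more, accounting for the final 1, when S contains all atoms. *)
Lemma card_DW1_from_bot :
  #|[set d in DW1 L | d \bot == \bot]| =
  (\sum_(k < #|atoms|.+1) k.+1 * 'C(#|atoms|, k) + 1)%N.
Proof.
rewrite card_DW1_from ?bot_neq_top // bases_bot.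
rewrite big_imset /=; last exact: id_on_inj.
have upS S : S \in powerset atoms -> up_atoms (id_on S) = S.
  rewrite inE => SA; apply/setP => x; rewrite inE ffunE.
  case: ifPn => [xS|xS]; first by rewrite lexx (subsetP SA).
  by case: (boolP (x \in atoms)) => //= /atomN0/negPf; rewrite lex0.
under eq_bigr => S SA do rewrite card_top_values ?bot_neq_top // upS //.
rewrite big_split /=; congr addn; last first.
  rewrite (bigD1 atoms) ?inE //= eqxx big1 // => S.
  by case/andP => _ /negPf->.
rewrite (partition_big (fun S : {set L} => inord #|S| : 'I_#|atoms|.+1) xpredT) //=.
apply: eq_bigr => k _.
rewrite (eq_bigl (mem [set S : {set L} | S \subset atoms & #|S| == k])); last first.
  move=> S; rewrite !inE; apply/andb_id2l => SA.
  by rewrite -val_eqE /= inordK // ltnS subset_leq_card.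
rewrite (eq_bigr (fun=> k.+1)); last by move=> S /setIdP[_ /eqP->].
by rewrite sum_nat_const cards_draws mulnC.
Qed.

(** * The operators that send the bottom to the top *)

(** When d(0) = 1 the terms of the rule for atoms x <> y must join to 1.  If d(y) <> 1
    and d(x) is neither 1 nor y, then d(x) /\ y = 0 and the two other terms lie
    below d(y), which is impossible.  Conversely, if d exchanges x and y the
    first two terms are y and x, and if d(x) or d(y) is 1 the condition
    x \/ d(x) = 1 for single atoms suffices. *)
Lemma DW1_topP d : d \bot = \top ->
  reflect [/\ d \top \in top_values d,
              forall x, x \in atoms -> x `|` d x = \top &
              forall x y, x \in atoms -> y \in atoms -> x != y ->
                d x != \top -> d y != \top -> d x = y]
          (d \in DW1 L).
Proof.
move=> d0.
have rule0 x : product_rule d x \bot = x `|` d x.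
  by rewrite product_rulex0 d0 !meetx1.
apply: (iffP (DW1_qaP d)) => [[d1 dB dA]|[d1 dB dA]]; split=> //.
- by move=> x xA; rewrite -rule0 -dB.
- move=> x y xA yA xy dx1; apply: contraNeq => dxy.
  have dxy0 : d x `&` y = \bot.
    by rewrite meetC meet_atom // (negPf dx1) (negPf dxy).
  rewrite -le1x -d0 (dA x y xA yA xy) /product_rule dxy0 join0x.
  by rewrite leUx !leIr.
- by move=> x xA; rewrite rule0 dB.
move=> x y xA yA xy; rewrite d0; apply/esym/eqP; rewrite -le1x /product_rule.
case: (eqVneq (d x) \top) => [->|dx].
  by rewrite !meet1x joinAC dB // join1x.
case: (eqVneq (d y) \top) => [->|dy].
  by rewrite !meetx1 -joinA dB // joinx1.
rewrite (dA x y) // (dA y x) // 1?eq_sym // !meetxx.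
by rewrite lexUl // join_atom // (negPf (atomN0 xA)) (negPf xy).
Qed.

(** The deviating atoms: those with a value other than the generic value 1. *)
Definition dev_atoms d : {set L} := [set x in atoms | d x != \top].

Lemma in_dev_atoms d x :
  x \in atoms -> (x \in dev_atoms d) = (d x != \top).
Proof. by move=> xA; rewrite inE xA. Qed.

Definition dev1 (p : L * L) : {ffun L -> L} :=
  [ffun z => if z == \top then \bot else if z == p.1 then p.2 else \top].

Definition dev2 x y : {ffun L -> L} :=
  [ffun z => if z == \top then \bot else if z == x then y
             else if z == y then x else \top].

Lemma bases_topP g :
  reflect [/\ g \bot = \top, g \top = \bot,
              forall x, x \in dev_atoms g -> g x \in atoms :\ x &
              {in dev_atoms g &, forall x y, x != y -> g x = y}]
          (g \in bases \top).
Proof.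
apply: (iffP setIdP) => [[gD /andP[/eqP g0 /eqP g1]] | [g0 g1 gA g2]].
  have [_ gB gA] := DW1_topP g0 gD; split=> // [x|x y] /setIdP[xA gx1].
    have := gB x xA; rewrite join_atom //; case: ifPn => [_ x1|].
      by have := atomN1 xA; rewrite x1 eqxx.
    by rewrite negb_or !inE gx1 andbT => /andP[-> ->].
  by case/setIdP=> yA gy1 xy; apply: gA.
rewrite g0 g1 !eqxx; split=> //; apply/DW1_topP => //.
rewrite g1; split=> [|x xA|x y xA yA xy gx gy]; first exact: bot_in_top_values.
  case: (eqVneq (g x) \top) => [->|gx1]; first by rewrite joinx1.
  have /setD1P[gxx gxA] : g x \in atoms :\ x by apply: gA; rewrite inE xA.
  by rewrite join_atom // (negPf gxx) (negPf (atomN0 gxA)).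
by apply: g2 => //; rewrite inE ?xA ?yA.
Qed.

(** Any two deviating atoms are exchanged, so a third one would be the image of the
    first together with the second. *)
Lemma card_dev_atoms g : g \in bases \top -> (#|dev_atoms g| < 3)%N.
Proof.
case/bases_topP => _ _ gA g2; rewrite ltnNge; apply/negP => /card_geqP[s []].
case: s => [|x [|y [|z [|? ?]]]] //=.
rewrite !inE negb_or andbT => /andP[/andP[xy xz] yz] _ sub.
have mem t : t \in [:: x; y; z] -> t \in dev_atoms g by exact: sub.
have gxy : g x = y by apply: g2 => //; apply: mem; rewrite !inE eqxx ?orbT.
have gxz : g x = z by apply: g2 => //; apply: mem; rewrite !inE eqxx ?orbT.
by move: yz; rewrite -gxy gxz eqxx.
Qed.

(** A deviating atom is sent to a different atom, which is not above it. *)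
Lemma card_up_atoms_top g : g \in bases \top ->
  #|up_atoms g| = (#|atoms| - #|dev_atoms g|)%N /\
  (up_atoms g == atoms) = (#|dev_atoms g| == 0).
Proof.
case/bases_topP => _ _ gA _.
have upE : up_atoms g = atoms :\: dev_atoms g.
  apply/setP => x; rewrite in_setD [x \in up_atoms g]inE.
  case: (boolP (x \in dev_atoms g)) => [xD | xD] /=.
    have /setD1P[gxx gxA] := gA x xD.
    rewrite le_atom // eq_sym [x == _]eq_sym (negPf gxx) orbF eq_sym.
    by case: (boolP (x \in atoms)) => //= /atomN0/negPf.
  move: xD; rewrite inE; case: (x \in atoms) => //=.
  by rewrite negbK => /eqP->; rewrite lex1.
have subA : dev_atoms g \subset atoms by apply/subsetP => x /setIdP[].
split; rewrite upE; first by rewrite cardsD (setIidPr subA).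
rewrite cards_eq0 eqEsubset subsetDl /= subsetD subxx /= disjoint_sym.
by rewrite -setI_eq0 (setIidPl subA).
Qed.

Definition dev_class k := [set g in bases \top | #|dev_atoms g| == k].

Lemma card_dev_class0 : #|dev_class 0| = 1%N.
Proof.
suff -> : dev_class 0 = [set at_top (Cop \top) \bot] by rewrite cards1.
apply/setP => g; rewrite in_set1; apply/setIdP/eqP => [[gD]|->].
  rewrite cards_eq0 => /eqP/setP gdev; have [g0 g1 _ _] := bases_topP _ gD.
  apply/ffunP => x; rewrite !ffunE; case: (bot_top_atomP x) => [||y yA].
  - by rewrite (negPf bot_neq_top).
  - by rewrite eqxx.
  have := gdev y; rewrite (negPf (atomN1 yA)) !inE; move: yA; rewrite inE => -> /=.
  by move/negbFE/eqP.
have dev0 : dev_atoms (at_top (Cop \top) \bot) = set0.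
  apply/setP => x; rewrite inE [RHS]inE; case: (boolP (x \in atoms)) => //= xA.
  by rewrite at_topF ?(atomN1 xA) // ffunE eqxx.
split; last by rewrite dev0 cards0.
apply/bases_topP; rewrite at_top_top at_topF ?bot_neq_top // ffunE.
by split=> // [x|x y]; rewrite dev0 inE.
Qed.

(** A single deviating atom may be sent to any other atom. *)
Lemma card_dev_class1 : #|dev_class 1| = (#|atoms| * #|atoms|.-1)%N.
Proof.
pose P := [set p : L * L | (p.1 \in atoms) && (p.2 \in atoms :\ p.1)].
have devP p : p \in P -> dev_atoms (dev1 p) = [set p.1].
  move=> /setIdP[xA /setD1P[yx yA]]; apply/setP => z; rewrite in_set1 inE ffunE.
  case: (eqVneq z p.1) => [->|zx]; first by rewrite xA (negPf (atomN1 xA)) atomN1.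
  case: (eqVneq z \top) => [->|_]; last by rewrite eqxx andbF.
  by rewrite inE eqxx andbF.
have dev1x p : p \in P -> dev1 p p.1 = p.2.
  by move=> /setIdP[xA _]; rewrite ffunE (negPf (atomN1 xA)) eqxx.
have -> : dev_class 1 = dev1 @: P.
  apply/setP => g; apply/setIdP/imsetP => [[gD /cards1P[x devx]]|[p pP ->]].
    have [g0 g1 gA _] := bases_topP _ gD.
    have xD : x \in dev_atoms g by rewrite devx set11.
    have xA : x \in atoms by case/setIdP: xD.
    exists (x, g x); first by rewrite inE /= xA gA.
    apply/ffunP => z; rewrite ffunE /=; case: (bot_top_atomP z) => [||y yA].
    - by rewrite (negPf bot_neq_top) eq_sym (negPf (atomN0 xA)).
    - by rewrite eqxx.
    rewrite (negPf (atomN1 yA)); case: eqP => [-> //|/eqP yx].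
    have : y \notin dev_atoms g by rewrite devx in_set1.
    by rewrite inE yA negbK => /eqP.
  rewrite devP // cards1 eqxx; split=> //.
  have /setIdP[xA pD] := pP.
  apply/bases_topP; rewrite devP //; split.
  - by rewrite ffunE (negPf bot_neq_top) eq_sym (negPf (atomN0 xA)).
  - by rewrite ffunE eqxx.
  - by move=> x /set1P->; rewrite dev1x.
  by move=> x y /set1P-> /set1P->; rewrite eqxx.
rewrite card_in_imset => [|p q pP qP pq]; last first.
  have p1 : p.1 = q.1 by apply: set1_inj; rewrite -!devP // pq.
  apply: injective_projections => //.
  by rewrite -(dev1x p) // pq p1 dev1x.
rewrite -sum1_card (eq_bigl (fun p => (p.1 \in atoms) && (p.2 \in atoms :\ p.1))).
  rewrite -(pair_big_dep _ (fun x y => y \in atoms :\ x) (fun _ _ => 1%N)) /=.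
  rewrite (eq_bigr (fun=> #|atoms|.-1)) ?sum_nat_const // => x xA.
  by rewrite sum1_card (cardsD1 x atoms) (xA : x \in atoms).
by move=> p; rewrite [LHS]inE.
Qed.

(** Two deviating atoms are exchanged, so the operator is determined by the pair. *)
Lemma card_dev_class2 : #|dev_class 2| = 'C(#|atoms|, 2).
Proof.
rewrite -cards_draws -(card_in_imset (f := dev_atoms)).
  apply: eq_card => S; apply/imsetP/setIdP.
    case=> g /setIdP[gD g2] ->.
    by split=> //; apply/subsetP => x /setIdP[].
  case=> SA /cards2P[x [y [xy SE]]].
  have xA : x \in atoms by apply: (subsetP SA); rewrite SE !inE eqxx.
  have yA : y \in atoms by apply: (subsetP SA); rewrite SE !inE eqxx orbT.
  have dx : dev2 x y x = y by rewrite ffunE (negPf (atomN1 xA)) eqxx.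
  have dy : dev2 x y y = x.
    by rewrite ffunE (negPf (atomN1 yA)) eq_sym (negPf xy) eqxx.
  have devE : dev_atoms (dev2 x y) = S.
    apply/setP => z; rewrite SE in_set2 inE.
    case: (eqVneq z x) => [->|zx]; first by rewrite dx xA atomN1.
    case: (eqVneq z y) => [->|zy]; first by rewrite dy yA atomN1.
    rewrite ffunE (negPf zx) (negPf zy).
    case: (eqVneq z \top) => [->|]; last by rewrite eqxx andbF.
    by rewrite inE eqxx andbF.
  exists (dev2 x y) => //; apply/setIdP; split; last by rewrite devE SE cards2 xy.
  apply/bases_topP; rewrite devE SE; split.
  - rewrite ffunE (negPf bot_neq_top).
    by rewrite !(eq_sym \bot) (negPf (atomN0 xA)) (negPf (atomN0 yA)).
  - by rewrite ffunE eqxx.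
  - move=> z /set2P[]->; rewrite ?dx ?dy in_setD1 ?xA ?yA andbT //.
    by rewrite eq_sym.
  by move=> z t /set2P[]-> /set2P[]->; rewrite ?eqxx ?dx ?dy.
move=> g h /setIdP[gD /cards2P[x [y [xy gE]]]] /setIdP[hD _] gh.
have [g0 g1 _ g2] := bases_topP _ gD; have [h0 h1 _ h2] := bases_topP _ hD.
apply/ffunP => z; case: (bot_top_atomP z) => [||t tA]; rewrite ?g0 ?g1 ?h0 ?h1 //.
case: (boolP (t \in dev_atoms g)) => [tg|tg]; last first.
  have : t \notin dev_atoms h by rewrite -gh.
  by move: tg; rewrite !in_dev_atoms // !negbK => /eqP-> /eqP->.
have [w wg tw] : exists2 w, w \in dev_atoms g & t != w.
  move: tg; rewrite gE => /set2P[]->; [exists y | exists x];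
    rewrite ?set21 ?set22 //.
  by rewrite eq_sym.
by rewrite (g2 t w) // (h2 t w) // -gh.
Qed.

(** With k deviating atoms and m atoms in all, the values admissible at the top are
    the bottom, the m - k other atoms, and the top if k = 0. *)
Lemma card_DW1_from_top :
  #|[set d in DW1 L | d \bot == \top]| =
  (#|atoms| + 2 + #|atoms| * #|atoms|.-1 * #|atoms|
   + 'C(#|atoms|, 2) * #|atoms|.-1)%N.
Proof.
rewrite card_DW1_from ?bot_neq_top //.
rewrite (partition_big (fun g => inord #|dev_atoms g| : 'I_3) xpredT) //=.
have classE (k : 'I_3) :
    (\sum_(g in bases \top | inord #|dev_atoms g| == k) #|top_values g|
     = #|dev_class k| * ((#|atoms| - k).+1 + (k == 0 :> nat)))%N.
  rewrite -sum_nat_const [RHS](eq_bigl (fun g =>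
    (g \in bases \top) && (inord #|dev_atoms g| == k))).
    apply: eq_bigr => g /andP[gD /eqP <-].
    have [upc upe] := card_up_atoms_top gD.
    by rewrite card_top_values ?bot_neq_top // upc upe inordK // card_dev_atoms.
  move=> g; rewrite [LHS]inE; apply/andb_id2l => gD.
  by rewrite -val_eqE /= inordK // card_dev_atoms.
under eq_bigr => k _ do rewrite classE.
rewrite !big_ord_recl big_ord0 /= card_dev_class0 card_dev_class1 card_dev_class2.
have := atoms_gt1; case: #|atoms| => [|[|m]] // _.
rewrite /bump /=; lia.
Qed.

End TwoAtoms.

(** * The operators that send the bottom to an atom *)

Lemma lambda_DW1 c : c \in atoms -> lambda c \in DW1 L.
Proof.
move=> cA.
have l0 : lambda c \bot = c.
  by rewrite ffunE eq_sym (negPf (atomN0 cA)) (negPf (atom_nontrivial cA)).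
have lc : lambda c c = \bot by rewrite ffunE eqxx.
have lx x : x \in atoms -> x != c -> lambda c x = c.
  by move=> xA xc; rewrite ffunE (negPf xc) (negPf (atomN1 xA)).
apply/DW1_qaP; rewrite l0; split=> [|x xA|x y xA yA xy].
- by rewrite ffunE eqxx orbT bot_in_top_values.
- rewrite product_rulex0 l0; case: (eqVneq x c) => [->|xc].
    by rewrite meetxx lc meet0x joinx0.
  by rewrite lx // meetxx meetUK.
wlog yc : x y xA yA xy / y != c.
  move=> wl; case: (eqVneq y c) => [yc|]; last exact: wl.
  by rewrite product_ruleC; apply: wl; rewrite -?yc // eq_sym.
rewrite /product_rule (lx y) //; case: (eqVneq x c) => [->|xc].
  by rewrite lc !meet0x meetxx join0x joinx0.
by rewrite lx // meetxx; apply/esym/join_r; rewrite leUx leIl leIr.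
Qed.

(** For an atom x <> c the rule with the bottom gives c <= g(x).  Here g(x) = 1 is
    excluded by an atom y distinct from x and c, because y would then be below c;
    so g(x) = c.  Finally x <= g(c) is impossible, since the rule for (x, c) would
    put x below c, so g(c) is 0 or c. *)
Lemma bases_atom c : (2 < #|atoms|)%N -> c \in atoms ->
  bases c = [set at_top (Cop c) \bot; lambda c].
Proof.
move=> atoms_gt2 cA; have N01 := atom_nontrivial cA.
apply/setP => g; rewrite in_set2; apply/idP/orP.
  case/setIdP=> gD /andP[/eqP g0 /eqP g1].
  have [_ gB gA] := DW1_qaP _ gD.
  have gx x : x \in atoms -> x != c -> g x = c.
    move=> xA xc; have := gB x xA; rewrite product_rulex0 g0.
    have -> : x `&` c = \bot.
      by rewrite meet_atom // (negPf (atomN1 cA)) eq_sym (negPf xc).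
    rewrite join0x => /esym/eqP; rewrite eq_meetr atom_le //.
    case/orP => /eqP gx1 //.
    have /card_gt0P[y] : (0 < #|atoms :\ x :\ c|)%N.
      move: atoms_gt2; rewrite (cardsD1 x atoms) xA (cardsD1 c (atoms :\ x)).
      by case: (c \in _); rewrite ?ltnS // => /ltnW.
    case/setD1P => yc /setD1P[yx yA].
    have := gA x y xA yA; rewrite eq_sym => /(_ yx).
    rewrite g0 /product_rule gx1 !meet1x => cE.
    have : y <= c by rewrite cE -joinA leUl.
    by rewrite le_atom // (negPf (atomN0 yA)) (negPf yc).
  have gc : g c = \bot \/ g c = c.
    have gcx x : x \in atoms -> x != c -> ~~ (x <= g c).
      move=> xA xc; apply/negP => xgc.
      have := gA x c xA cA xc; rewrite g0 => cE.
      have : x <= c by rewrite cE /product_rule (meet_l xgc) joinAC lexUr.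
      by rewrite le_atom // (negPf (atomN0 xA)) (negPf xc).
    case: (bot_top_atomP (g c)) gcx => [||x xA] gcx; first by left.
      have /card_gt0P[y /setD1P[yc yA]] : (0 < #|atoms :\ c|)%N.
        by move: atoms_gt2; rewrite (cardsD1 c atoms) cA ltnS => /ltnW.
      by have := gcx y yA yc; rewrite lex1.
    case: (eqVneq x c) => [->|xc]; first by right.
    by have := gcx x xA xc; rewrite lexx.
  case: gc => gc; [right | left]; apply/eqP/ffunP => x; rewrite !ffunE;
    case: (bot_top_atomP x) => [||y yA];
    rewrite ?eqxx ?orbT ?g0 ?g1 ?(negPf N01) //.
  - by rewrite eq_sym (negPf (atomN0 cA)).
  - rewrite (negPf (atomN1 yA)) orbF.
    by case: eqP => [->|/eqP yc] //; rewrite gx.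
  rewrite (negPf (atomN1 yA)).
  by case: (eqVneq y c) => [->|yc] //; rewrite gx.
case=> /eqP->; apply/setIdP; last first.
  rewrite lambda_DW1 // !ffunE eqxx orbT eqxx.
  by rewrite [\bot == c]eq_sym (negPf (atomN0 cA)) (negPf N01) eqxx.
by rewrite at_top_bot_DW1 ?Cop_DW1 // at_top_top at_topF // ffunE !eqxx.
Qed.

Lemma card_DW1_from_atom c : (2 < #|atoms|)%N -> c \in atoms ->
  #|[set d in DW1 L | d \bot == c]| = 3.
Proof.
move=> atoms_gt2 cA; have N01 := atom_nontrivial cA.
have upE d : (forall x, x \in atoms -> x != c -> d x = c) ->
    up_atoms d = if c <= d c then [set c] else set0.
  move=> dx; apply/setP => x; case: (eqVneq x c) => [->|xc].
    by rewrite inE cA; case: ifP; rewrite inE ?eqxx.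
  have -> : (x \in up_atoms d) = false.
    rewrite inE; apply/andP => -[xA]; rewrite dx // le_atom //.
    by rewrite (negPf (atomN0 xA)) (negPf xc).
  by case: ifP; rewrite !inE ?(negPf xc).
have upN k (U : {set L}) : #|U| = k -> (k < 3)%N -> (U == atoms) = false.
  move=> Uk k3; apply: contraTF atoms_gt2 => /eqP <-.
  by rewrite Uk -leqNgt.
have upC : up_atoms (at_top (Cop c) \bot) = [set c].
  rewrite upE => [|x xA _]; rewrite at_topF ?(atomN1 cA) ?(atomN1 xA) // ffunE //.
  by rewrite lexx.
have upL : up_atoms (lambda c) = set0.
  rewrite upE => [|x xA xc]; rewrite ffunE ?eqxx ?lex0 ?(negPf (atomN0 cA)) //.
  by rewrite (negPf xc) (negPf (atomN1 xA)).
rewrite card_DW1_from // bases_atom // big_setU1 ?big_set1 /=.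
  rewrite !card_top_values // upC upL (upN 1) ?cards1 // (upN 0) ?cards0 //.
rewrite in_set1; apply: contra_neqN (atomN0 cA) => /eqP/ffunP/(_ c).
by rewrite at_topF ?(atomN1 cA) // !ffunE eqxx.
Qed.

(** * The count for at least three atoms *)

Lemma card_DW1_qa : (2 < #|atoms|)%N ->
  #|DW1 L| = (\sum_(k < #|atoms|.+1) k.+1 * 'C(#|atoms|, k) + 1
   + (#|atoms| + 2 + #|atoms| * #|atoms|.-1 * #|atoms|
      + 'C(#|atoms|, 2) * #|atoms|.-1) + #|atoms| * 3)%N.
Proof.
move=> atoms_gt2; have atoms_gt1 := ltnW atoms_gt2.
rewrite card_DW1_sum sum_bot_top_atoms ?bot_neq_top //.
rewrite card_DW1_from_bot // card_DW1_from_top //.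
rewrite (eq_bigr (fun=> 3)) ?sum_nat_const // => c; exact: card_DW1_from_atom.
Qed.

End QuasiAntichain.

Lemma card_DW1_rat m : (0 < m)%N ->
  ((\sum_(k < m.+1) k.+1 * 'C(m, k) + 1
   + (m + 2 + m * m.-1 * m + 'C(m, 2) * m.-1) + m * 3)%N%:R =
   (3 * m.+2%:R ^+ 3 - 22 * m.+2%:R ^+ 2 + 61 * m.+2%:R - 50) / 2
        + (\sum_(1 <= k < m.+1) k.+1 * 'C(m, k))%N%:R :> rat)%R.
Proof.
case: m => // m _.
rewrite -(big_mkord xpredT (fun k => k.+1 * 'C(m.+1, k))%N) big_ltn // bin0.
move: (\sum_(1 <= k < _) _)%N => s.
have b2 : ('C(m.+1, 2)%:R = m.+1%:R * m%:R / 2 :> rat)%R.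
  rewrite -GRing.natrM -[m in (_ * m)%N]bin1 mul_bin_diag mulnC GRing.natrM.
  by rewrite GRing.mulfK.
move: 'C(m.+1, 2) b2 => b b2.
rewrite succnK !(GRing.natrD, GRing.natrM) b2; by field.
Qed.

(** * The lattice with two atoms *)

Section M2.

Context {disp : Order.disp_t} {L : finTBLatticeType disp}.
Variables (a b : L).
Hypotheses (qaL : quasi_antichain L) (atomsE : atom_set L = [set a; b]).
Hypothesis ab : a != b.

Let aA : a \in atom_set L. Proof. by rewrite atomsE set21. Qed.
Let bA : b \in atom_set L. Proof. by rewrite atomsE set22. Qed.
Let N01 : \bot != \top :> L. Proof. exact: atom_nontrivial aA. Qed.

Notation bool2 := (bool * bool)%type.
Notation O2 := (false, false).
Notation A2 := (true, false).
Notation B2 := (false, true).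
Notation I2 := (true, true).

(** The isomorphism from the Boolean algebra of pairs of bits. *)
Definition M2_elt (p : bool2) : L :=
  match p with O2 => \bot | A2 => a | B2 => b | I2 => \top end.

Definition meet2 (p q : bool2) : bool2 := (p.1 && q.1, p.2 && q.2).
Definition join2 (p q : bool2) : bool2 := (p.1 || q.1, p.2 || q.2).

Lemma M2_eltI p q : M2_elt (meet2 p q) = M2_elt p `&` M2_elt q.
Proof.
move: p q => [[] []] [[] []] /=;
  rewrite ?meet0x ?meetx0 ?meet1x ?meetx1 ?meetxx // ?(meet_atom qaL) //.
  by rewrite (negPf (atomN1 bA)) eq_sym (negPf ab).
by rewrite (negPf (atomN1 aA)) (negPf ab).
Qed.

Lemma M2_eltU p q : M2_elt (join2 p q) = M2_elt p `|` M2_elt q.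
Proof.
move: p q => [[] []] [[] []] /=;
  rewrite ?join0x ?joinx0 ?join1x ?joinx1 ?joinxx // ?(join_atom qaL) //.
  by rewrite (negPf (atomN0 bA)) eq_sym (negPf ab).
by rewrite (negPf (atomN0 aA)) (negPf ab).
Qed.

Lemma M2_elt_inj : injective M2_elt.
Proof.
have neqs := (negPf N01, negPf (atomN0 aA), negPf (atomN0 bA),
  negPf (atomN1 aA), negPf (atomN1 bA), negPf ab).
by move=> [[] []] [[] []] //= /eqP; rewrite ?neqs // eq_sym neqs.
Qed.

Lemma M2_elt_surj x : exists p, x = M2_elt p.
Proof.
case: (bot_top_atomP x) => [||y]; [by exists O2 | by exists I2 |].
by rewrite atomsE => /set2P[]->; [exists A2 | exists B2].
Qed.

Notation table := (bool2 * bool2 * bool2 * bool2)%type.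

(** An operator on M_2 is encoded by its values at 0, a, b and 1. *)
Definition table_op (v : table) : {ffun L -> L} :=
  let: (v0, va, vb, v1) := v in
  op4 a b (M2_elt v0) (M2_elt va) (M2_elt vb) (M2_elt v1).

Definition table_val (v : table) (p : bool2) : bool2 :=
  let: (v0, va, vb, v1) := v in
  match p with O2 => v0 | A2 => va | B2 => vb | I2 => v1 end.

Lemma table_opE v p : table_op v (M2_elt p) = M2_elt (table_val v p).
Proof.
move: v p => [[[v0 va] vb] v1] [[] []] /=; rewrite ffunE ?eqxx //.
- by rewrite ![\top == _]eq_sym (negPf N01) (negPf (atomN1 aA)) (negPf (atomN1 bA)).
- by rewrite (negPf (atomN0 aA)).
by rewrite (negPf (atomN0 bA)) eq_sym (negPf ab).
Qed.

Lemma table_op_eq v (d : {ffun L -> L}) :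
  (forall p, d (M2_elt p) = M2_elt (table_val v p)) ->
  d = table_op v.
Proof.
by move=> dE; apply/ffunP => x; have [p ->] := M2_elt_surj x; rewrite table_opE.
Qed.

Lemma table_op_inj : injective table_op.
Proof.
move=> v w /ffunP vw.
have val_vw p : table_val v p = table_val w p.
  by apply: M2_elt_inj; rewrite -!table_opE.
move: v w val_vw {vw} => [[[v0 va] vb] v1] [[[w0 wa] wb] w1] E.
by rewrite (E O2 : v0 = w0) (E A2 : va = wa) (E B2 : vb = wb) (E I2 : v1 = w1).
Qed.

Lemma table_op_surj (d : {ffun L -> L}) : exists v, d = table_op v.
Proof.
have [v0 d0] := M2_elt_surj (d \bot); have [va da] := M2_elt_surj (d a).
have [vb db] := M2_elt_surj (d b); have [v1 d1] := M2_elt_surj (d \top).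
by exists (v0, va, vb, v1); apply: table_op_eq => -[[] []].
Qed.

Definition bool2s : seq bool2 := [:: O2; A2; B2; I2].

(** The difference rule, in a form that computes on concrete tables. *)
Definition is_DW1_table (v : table) : bool :=
  all (fun p => all (fun q => table_val v (meet2 p q) ==
    join2 (join2 (meet2 (table_val v p) q) (meet2 p (table_val v q)))
          (meet2 (table_val v p) (table_val v q))) bool2s) bool2s.

Lemma table_op_DW1 v : (table_op v \in DW1 L) = is_DW1_table v.
Proof.
have bool2sP p : p \in bool2s by move: p => [[] []].
apply/DW1P/allP => [vP p _ | vP x y].
  apply/allP => q _; have := vP (M2_elt p) (M2_elt q).
  by rewrite /product_rule -M2_eltI !table_opE -!M2_eltI -!M2_eltU => /M2_elt_inj->.
have [p ->] := M2_elt_surj x; have [q ->] := M2_elt_surj y.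
rewrite /product_rule -M2_eltI !table_opE -!M2_eltI -!M2_eltU; congr M2_elt.
exact/eqP/(allP (vP p (bool2sP p))).
Qed.

(** In the order in which [M2_ops_atom a b] lists its elements. *)
Definition atom_tables : seq table :=
  [:: (A2, A2, A2, A2); (A2, A2, A2, O2); (A2, O2, A2, O2); (A2, A2, I2, I2);
      (A2, O2, I2, B2); (A2, O2, I2, O2);
      (A2, A2, I2, O2); (A2, A2, I2, A2); (A2, A2, I2, B2)].

Definition top_tables : seq table :=
  [:: (I2, I2, I2, I2); (I2, B2, I2, B2); (I2, I2, A2, A2);
      (I2, B2, I2, O2); (I2, I2, A2, O2); (I2, B2, A2, O2);
      (I2, I2, I2, O2); (I2, I2, I2, A2); (I2, I2, I2, B2)].

Lemma atom_tablesP v : is_DW1_table v && (v.1.1.1 == A2) = (v \in atom_tables).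
Proof. by move: v => [[[[[] []] [[] []]] [[] []]] [[] []]]. Qed.

Lemma top_tablesP v : is_DW1_table v && (v.1.1.1 == I2) = (v \in top_tables).
Proof. by move: v => [[[[[] []] [[] []]] [[] []]] [[] []]]. Qed.

Lemma class_tables p (s : seq table) :
  (forall v, is_DW1_table v && (v.1.1.1 == p) = (v \in s)) ->
  [set d in DW1 L | d \bot == M2_elt p] = [set table_op v | v in s].
Proof.
move=> sP; apply/setP => d; have [v ->] := table_op_surj d.
rewrite (mem_imset _ _ table_op_inj) inE table_op_DW1 -[\bot]/(M2_elt O2) table_opE.
rewrite (inj_eq M2_elt_inj) -sP; by move: v => [[[v0 va] vb] v1].
Qed.

Lemma card_tables (s : seq table) : uniq s -> #|[set table_op v | v in s]| = size s.
Proof.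
by move=> s_uniq; rewrite card_imset; [exact/card_uniqP | exact: table_op_inj].
Qed.

Lemma imset_not_top (f : L -> {ffun L -> L}) :
  [set f u | u in [set~ \top]] = [set f (M2_elt O2); f (M2_elt A2); f (M2_elt B2)].
Proof.
have -> : [set~ \top] = [set \bot; a; b] :> {set L}.
  apply/setP => x; rewrite !inE; have [p ->] := M2_elt_surj x.
  rewrite -[\bot]/(M2_elt O2) -[a]/(M2_elt A2) -[b]/(M2_elt B2) -[\top]/(M2_elt I2).
  by rewrite !(inj_eq M2_elt_inj); move: p => [[] []].
by rewrite imsetU imsetU1 !imset_set1.
Qed.

Lemma Cop_table p : Cop (M2_elt p) = table_op (p, p, p, p).
Proof. by apply: table_op_eq => -[[] []]; rewrite ffunE. Qed.

Lemma at_top_table v0 va vb v1 u :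
  at_top (table_op (v0, va, vb, v1)) (M2_elt u) = table_op (v0, va, vb, u).
Proof.
apply: table_op_eq => p; rewrite ffunE table_opE -[\top]/(M2_elt I2).
by rewrite (inj_eq M2_elt_inj); move: p => [[] []].
Qed.

Lemma psi_table : psi a = table_op (A2, A2, I2, I2).
Proof.
apply: table_op_eq => p; rewrite ffunE -[a]/(M2_elt A2) -M2_eltU.
by move: p => [[] []].
Qed.

Lemma lambda_table : lambda a = table_op (A2, O2, A2, O2).
Proof.
apply: table_op_eq => p; rewrite ffunE.
rewrite -[a]/(M2_elt A2) -[\top]/(M2_elt I2) -[\bot]/(M2_elt O2).
by rewrite !(inj_eq M2_elt_inj); move: p => [[] []].
Qed.

Lemma M2_ops_atomE : M2_ops_atom a b = [set table_op v | v in atom_tables].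
Proof.
rewrite /M2_ops_atom imset_not_top.
have -> : Phi a b = table_op (A2, O2, I2, B2) by [].
rewrite psi_table lambda_table (Cop_table A2 : Cop a = _) -[\bot]/(M2_elt O2).
rewrite !at_top_table; apply/setP => d; have [v ->] := table_op_surj d.
by rewrite (mem_imset _ _ table_op_inj) !inE !(inj_eq table_op_inj) -!orbA.
Qed.

Lemma M2_ops_topE : M2_ops_top a b = [set table_op v | v in top_tables].
Proof.
rewrite /M2_ops_top imset_not_top.
have -> : phi1 a b = table_op (I2, B2, I2, B2) by [].
have -> : phi2 a b = table_op (I2, I2, A2, A2) by [].
have -> : phi3 a b = table_op (I2, B2, A2, O2) by [].
rewrite (Cop_table I2 : Cop \top = _) -[\bot]/(M2_elt O2).
rewrite !at_top_table; apply/setP => d; have [v ->] := table_op_surj d.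
by rewrite (mem_imset _ _ table_op_inj) !inE !(inj_eq table_op_inj) -!orbA.
Qed.

Lemma M2_class_atom :
  [set d in DW1 L | d \bot == a] = M2_ops_atom a b /\ #|M2_ops_atom a b| = 9.
Proof.
by rewrite M2_ops_atomE card_tables // -(class_tables atom_tablesP).
Qed.

Lemma M2_class_top :
  [set d in DW1 L | d \bot == \top] = M2_ops_top a b /\ #|M2_ops_top a b| = 9.
Proof.
by rewrite M2_ops_topE card_tables // -(class_tables top_tablesP).
Qed.

End M2.

Lemma atom_in_atoms {disp} (L : finTBLatticeType disp) (x y : L) :
  atom x -> atom y -> x <> y -> x \in atom_set L.
Proof.
move=> [x0 x_min] [y0 _] /eqP xy; rewrite inE -lt0x x0 /=.
apply: contra_neqN xy => /eqP x1; move: y0.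
case: (eqVneq y \top) => [-> //|y1].
by rewrite (x_min y) ?ltxx // x1 lt_neqAle y1 lex1.
Qed.

Lemma M2_atoms {disp} (L : finTBLatticeType disp) (a b : L) :
  quasi_antichain L -> #|L| = 4 -> atom a -> atom b -> a <> b ->
  atom_set L = [set a; b].
Proof.
move=> qaL L4 a_atom b_atom ab.
have aA : a \in atom_set L by apply: atom_in_atoms ab.
have bA : b \in atom_set L by apply: atom_in_atoms (nesym ab).
apply/esym/eqP; rewrite eqEcard subUset !sub1set aA bA /= cards2.
have /eqP-> := ab.
by have := card_atom_set (atom_nontrivial aA); rewrite L4 => -[<-].
Qed.

Lemma M2_difference_operators {disp} (L : finTBLatticeType disp) (a b : L) :
  quasi_antichain L -> #|L| = 4 -> atom a -> atom b -> a <> b ->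
  [/\ #|DW1 L| = 36,
      DW1 L = Der L :|: M2_ops_atom a b :|: M2_ops_atom b a :|: M2_ops_top a b,
      #|Der L| = 9 &
      [/\ [set d in DW1 L | d \bot == a] = M2_ops_atom a b
            /\ #|M2_ops_atom a b| = 9,
          [set d in DW1 L | d \bot == b] = M2_ops_atom b a
            /\ #|M2_ops_atom b a| = 9 &
          [set d in DW1 L | d \bot == \top] = M2_ops_top a b
            /\ #|M2_ops_top a b| = 9]].
Proof.
move=> qaL L4 a_atom b_atom /[dup] ab /eqP abN.
have atomsE := M2_atoms qaL L4 a_atom b_atom ab.
have baN : b != a by rewrite eq_sym.
have atomsE' : atom_set L = [set b; a] by rewrite atomsE setUC.
have atoms2 : #|atom_set L| = 2 by rewrite atomsE cards2 abN.
have atoms_gt1 : (1 < #|atom_set L|)%N by rewrite atoms2.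
have N01 := bot_neq_top atoms_gt1.
have [ca na] := M2_class_atom qaL atomsE abN.
have [cb nb] := M2_class_atom qaL atomsE' baN.
have [ct nt] := M2_class_top qaL atomsE abN.
have DerE := Der_qa qaL atoms_gt1.
have nDer : #|Der L| = 9.
  by rewrite DerE card_DW1_from_bot // atoms2 !big_ord_recl big_ord0.
split=> //.
  rewrite card_DW1_sum sum_bot_top_atoms // -DerE nDer ct nt atomsE.
  by rewrite big_setU1 ?inE //= big_set1 ca cb na nb.
rewrite DerE -ca -cb -ct; apply/setP => d; rewrite !in_setU.
have classE v : (d \in [set d in DW1 L | d \bot == v])
                = (d \in DW1 L) && (d \bot == v) by rewrite inE.
rewrite !classE -!andb_orr; case: (bot_top_atomP (d \bot)) => [||x].
- by rewrite eqxx andbT.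
- by rewrite eqxx !orbT andbT.
by rewrite atomsE => /set2P[]->; rewrite eqxx !orbT andbT.
Qed.

Theorem theorem4p13 :
  (forall (disp : Order.disp_t) (L : finTBLatticeType disp) (a b : L),
     quasi_antichain L -> #|L| = 4 -> atom a -> atom b -> a <> b ->
     [/\ #|DW1 L| = 36,
         DW1 L = Der L :|: M2_ops_atom a b :|: M2_ops_atom b a
                   :|: M2_ops_top a b,
         #|Der L| = 9 &
         [/\ [set d in DW1 L | d \bot%O == a] = M2_ops_atom a b
               /\ #|M2_ops_atom a b| = 9,
             [set d in DW1 L | d \bot%O == b] = M2_ops_atom b a
               /\ #|M2_ops_atom b a| = 9 &
             [set d in DW1 L | d \bot%O == \top%O] = M2_ops_top a b
               /\ #|M2_ops_top a b| = 9]])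
  /\
  (forall (n : nat) (disp : Order.disp_t) (L : finTBLatticeType disp),
     (5 <= n)%N -> quasi_antichain L -> #|L| = n ->
     (#|DW1 L|%:R =
        (3 * n%:R ^+ 3 - 22 * n%:R ^+ 2 + 61 * n%:R - 50) / 2
        + (\sum_(1 <= k < (n - 2).+1) k.+1 * 'C(n - 2, k))%N%:R :> rat)%R).
Proof.
split=> [disp L a b|n disp L n5 qaL Ln]; first exact: M2_difference_operators.
have N01 : \bot != \top :> L.
  apply: contraTneq n5 => bot_top; rewrite -Ln -ltnNge.
  apply: (@leq_ltn_trans 1) => //; apply/fintype_le1P.
  have all0 (z : L) : z = \bot by apply/eqP; rewrite -lex0 bot_top lex1.
  by move=> x y; rewrite [x]all0 [y]all0.
have nE : n = #|atom_set L|.+2 by rewrite -Ln card_atom_set.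
have atoms_gt2 : (2 < #|atom_set L|)%N by rewrite nE in n5.
by rewrite nE subn2 card_DW1_qa // card_DW1_rat // (ltn_trans _ atoms_gt2).
Qed.
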